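(* Let $N, D, K \ge 1$ be integers, let $x_1,\dots,x_N \in \mathbb{R}^D$ be data points, let $\nu \in (0,1)$, and let $g$ be an activation function (linear or sigmoid), applied componentwise to vectors in $\mathbb{R}^K$. Let $w \in \mathbb{R}^K$ and $V \in \mathbb{R}^{K\times D}$ be obtained from solving, for a fixed value $r_0 \in \mathbb{R}$ of the bias, $$\underset{w, V}{\operatorname{argmin}}\ \frac{1}{2}\|w\|_2^2 + \frac{1}{2}\|V\|_F^2 + \frac{1}{\nu}\cdot\frac{1}{N}\sum_{n=1}^N \max\bigl(0,\ r_0 - \langle w, g(Vx_n)\rangle\bigr).$$ Given these $w$ and $V$, the solution to the problem $$\underset{r}{\operatorname{argmin}}\ \left(\frac{1}{N\nu}\sum_{n=1}^N \max(0,\ r-\hat{y}_n)\right) - r$$ is given by the $\nu$-th quantile of $\{\hat{y}_n\}_{n=1}^N$, where $$\hat{y}_n = \langle w, g(Vx_n)\rangle .$$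
   Context: Here $\|\cdot\|_F$ is the Frobenius norm, and $\langle\cdot,\cdot\rangle$, $\|\cdot\|_2$ are the Euclidean inner product and norm. The matrix $V$ holds the input-to-hidden weights and $w$ the hidden-to-output weights of a feed-forward network with one hidden layer of $K$ units and one output node; $r$ is a real bias. The two minimizations are the two steps of an alternating scheme: the bias is first held fixed (at $r_0$) while $w, V$ are optimized, and then $r$ is optimized with $w, V$ fixed. The source gives no formal definition of ''$\nu$-th quantile''; the term is used in its usual sense for a finite collection of real numbers, and in the source's derivation it is the value $r$ obtained by setting the derivative of the objective in $r$ to zero, i.e. from the condition $\frac{1}{N}\#\{n : \hat{y}_n < r\} = \nu$. *)

(* Defs.v *)
From mathcomp Require Import all_boot all_order all_algebra.
From mathcomp Require Import reals sequences.

Set Implicit Arguments.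
Unset Strict Implicit.
Unset Printing Implicit Defensive.

Import Order.TTheory GRing.Theory Num.Theory.
Local Open Scope ring_scope.

Definition is_argmin (R : realType) (T : Type) (f : T -> R) (t : T) : Prop :=
  forall s : T, f t <= f s.

Definition dotp (R : realType) (k : nat) (u v : 'cV[R]_k) : R :=
  \sum_(i < k) u i 0 * v i 0.

(* The library's norm [`|_|] on matrices is the max norm, hence these two. *)
Definition norm2 (R : realType) (k : nat) (u : 'cV[R]_k) : R :=
  Num.sqrt (dotp u u).

Definition normF (R : realType) (k d : nat) (A : 'M[R]_(k, d)) : R :=
  Num.sqrt (\sum_(i < k) \sum_(j < d) A i j ^+ 2).

Definition sigmoid (R : realType) (t : R) : R := (1 + expR (- t))^-1.

(* A linear activation may have any slope; slope 1 is the identity. *)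
Definition is_activation (R : realType) (g : R -> R) : Prop :=
  (exists a : R, forall t : R, g t = a * t) \/
  (forall t : R, g t = sigmoid t).

Definition score (R : realType) (K D : nat) (g : R -> R)
    (w : 'cV[R]_K) (V : 'M[R]_(K, D)) (x : 'cV[R]_D) : R :=
  dotp w (map_mx g (V *m x)).

Definition weights_objective (R : realType) (N D K : nat) (nu : R)
    (g : R -> R) (x : 'I_N -> 'cV[R]_D) (r0 : R)
    (wV : 'cV[R]_K * 'M[R]_(K, D)) : R :=
  2^-1 * norm2 wV.1 ^+ 2 + 2^-1 * normF wV.2 ^+ 2 +
  nu^-1 * (N%:R^-1 *
    \sum_(n < N) Num.max 0 (r0 - score g wV.1 wV.2 (x n))).

Definition bias_objective (R : realType) (N : nat) (nu : R)
    (y : 'I_N -> R) (r : R) : R :=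
  (N%:R * nu)^-1 * (\sum_(n < N) Num.max 0 (r - y n)) - r.

(* [q] is a nu-th quantile of the finite family [y], counted with
   multiplicity: the proportion of values strictly below [q] is at most [nu]
   and the proportion of values at or below [q] is at least [nu].  Such [q]
   form a single point, or, when [N * nu] is an integer [k], the closed
   interval between the k-th and (k+1)-th order statistics. *)
Definition is_quantile (R : realType) (N : nat) (nu : R)
    (y : 'I_N -> R) (q : R) : Prop :=
  #|[pred n : 'I_N | y n < q]|%:R / N%:R <= nu /\
  nu <= #|[pred n : 'I_N | y n <= q]|%:R / N%:R.

(* Main.v *)
Require Import Defs.
From mathcomp Require Import all_boot all_order all_algebra.
From mathcomp Require Import reals sequences.
From mathcomp Require Import lra.
Import Order.TTheory GRing.Theory Num.Theory.
Local Open Scope ring_scope.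

(** The bias objective is convex and piecewise linear in [r], and, up to the
factor [N * nu], its one-sided derivatives at [r] are [#{y < r} - N * nu] and
[#{y <= r} - N * nu].  It is therefore minimal at [r] exactly when the former
is nonpositive and the latter nonnegative, i.e. when [r] is a [nu]-quantile. *)

Definition hinge_sum {R : realType} {N : nat} (y : 'I_N -> R) (r : R) : R :=
  \sum_(n < N) Num.max 0 (r - y n).

(** Termwise, the hinge at [y n] has slope 1 to the right of [y n], slope 0 to the left, and both
    are subgradients at the kink. The ties [y n = r] may thus be put in [A] or left out, which
    covers both one-sided derivatives. *)
Lemma hinge_sum_subgradient {R : realType} {N : nat} (y : 'I_N -> R)
    (A : pred 'I_N) (r s : R) :
  (forall n, y n < r -> A n) -> (forall n, A n -> y n <= r) ->
  #|A|%:R * (s - r) <= hinge_sum y s - hinge_sum y r.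
Proof.
move=> ltA Ale.
rewrite /hinge_sum -sumrB -sum1_card natr_sum mulr_suml big_mkcond /=.
apply: ler_sum => n _; rewrite unfold_in.
have := ltA n; have := Ale n.
case: (A n) => [/(_ isT) yr _|_ ltA'].
  by rewrite (max_r (x := 0) (y := r - y n)) ?subr_ge0 // maxEle; case: ifP; lra.
have ry : r <= y n by rewrite leNgt; apply/negP => /ltA'.
by rewrite (max_l (x := 0) (y := r - y n)) ?subr_le0 // subr0 le_max lexx.
Qed.

(** Provides a step to the left of [r] that jumps over no value of [y], so that [hinge_sum y] is
    affine between [s] and [r]. *)
Lemma exists_lt_ge_smaller {R : realType} {N : nat} (y : 'I_N -> R) (r : R) :
  exists2 s, s < r & forall n, y n < r -> y n <= s.
Proof.
(* The default [r - 1] keeps [s] below [r] when no value lies below [r]. *)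
exists (\big[Num.max/(r - 1)]_(n < N | y n < r) y n).
  by apply/bigmax_ltP; split=> //; rewrite gtrBl.
by move=> n yr; apply: le_bigmax_cond.
Qed.

Lemma exists_gt_le_larger {R : realType} {N : nat} (y : 'I_N -> R) (r : R) :
  exists2 s, r < s & forall n, y n < s -> y n <= r.
Proof.
have [s sr ys] := exists_lt_ge_smaller (fun n => - y n) (- r).
exists (- s) => [|n yns]; first by rewrite ltrNr.
rewrite leNgt; apply/negP => ryn.
by have := ys n; rewrite ltrN2 => /(_ ryn); lra.
Qed.

Lemma card_le_natr {R : realType} {T : finType} (A B : pred T) :
  (forall n, A n -> B n) -> #|A|%:R <= #|B|%:R :> R.
Proof. by move=> AB; rewrite ler_nat; apply/subset_leq_card/subsetP. Qed.

Section Quantile.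
Context {R : realType} {N : nat} {nu : R} (y : 'I_N -> R).
Hypotheses (N_gt0 : (0 < N)%N) (nu_gt0 : 0 < nu).

Let NR_gt0 : 0 < N%:R :> R. Proof. by rewrite ltr0n. Qed.

Lemma is_quantile_card (q : R) :
  is_quantile nu y q <->
  #|[pred n | y n < q]|%:R <= N%:R * nu /\
  N%:R * nu <= #|[pred n | y n <= q]|%:R.
Proof. by rewrite /is_quantile ler_pdivrMr // ler_pdivlMr // (mulrC nu). Qed.

Lemma bias_objective_le (r s : R) :
  (bias_objective nu y r <= bias_objective nu y s) =
  (N%:R * nu * (s - r) <= hinge_sum y s - hinge_sum y r).
Proof.
have Nnu_gt0 : 0 < N%:R * nu by apply: mulr_gt0.
rewrite -[RHS]ler_pdivlMl // mulrBr /bias_objective -!/(hinge_sum y _).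
by apply/idP/idP; lra.
Qed.

Lemma quantile_argmin (r : R) :
  is_quantile nu y r -> is_argmin (bias_objective nu y) r.
Proof.
move=> /is_quantile_card [ltr ler] s; rewrite bias_objective_le.
(* The right derivative bounds the growth for [s >= r], the left one for [s < r], where the factor
   [s - r] is negative. *)
have [rs|sr] := leP r s.
  apply: le_trans (hinge_sum_subgradient y [pred n | y n <= r] r s _ _) => //.
    by rewrite ler_wpM2r ?subr_ge0.
  by move=> n /ltW.
apply: le_trans (hinge_sum_subgradient y [pred n | y n < r] r s _ _) => //.
  by rewrite ler_wnM2r // subr_le0 ltW.
by move=> n /ltW.
Qed.

Lemma argmin_quantile (r : R) :
  is_argmin (bias_objective nu y) r -> is_quantile nu y r.
Proof.
move=> rmin; apply/is_quantile_card; split; rewrite leNgt; apply/negP => bad.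
(* The subgradient is taken at [s], not at [r]: it exceeds [N * nu], so moving from [r] to [s] would
   lower the objective. *)
- have [s sr ys] := exists_lt_ge_smaller y r.
  have := rmin s; rewrite bias_objective_le.
  have := hinge_sum_subgradient y [pred n | y n <= s] s r
    (fun n => @ltW _ _ _ _) (fun n => id).
  have := lt_le_trans bad (card_le_natr _ [pred n | y n <= s] ys).
  have rs0 : 0 < r - s by rewrite subr_gt0.
  by rewrite -(ltr_pM2r rs0); lra.
(* Symmetrically, the slope between [r] and [s] is below [N * nu], so moving right would lower the
   objective. *)
- have [s rs ys] := exists_gt_le_larger y r.
  have := rmin s; rewrite bias_objective_le.
  have := hinge_sum_subgradient y [pred n | y n < s] s r
    (fun n => id) (fun n => @ltW _ _ _ _).
  have := le_lt_trans (card_le_natr [pred n | y n < s] _ ys) bad.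
  have sr0 : 0 < s - r by rewrite subr_gt0.
  by rewrite -(ltr_pM2r sr0); lra.
Qed.

(** The witness is the least sample value with at least [N * nu] values at or below it; the maximum
    is a candidate because [nu < 1]. *)
Lemma exists_quantile : nu < 1 -> exists q, is_quantile nu y q.
Proof.
move=> nu_lt1.
pose P n := N%:R * nu <= #|[pred m | y m <= y n]|%:R.
pose top := [arg max_(n > Ordinal N_gt0) y n]%O.
have Ptop : P top.
  rewrite /P /top; case: arg_maxP => // n _ nmax.
  rewrite (@eq_card _ _ 'I_N) => [|m]; last by rewrite !inE; apply: nmax.
  by rewrite card_ord ler_piMr ?ltW.
case: (arg_minP y Ptop) => n Pn nmin.
exists (y n); apply/is_quantile_card; split=> //.
rewrite leNgt; apply/negP => bad.
have : (0 < #|[pred m | (y m < y n)%R]|)%N.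
  by rewrite -(ltr_nat R); apply: lt_trans bad; apply: mulr_gt0.
case/card_gt0P => m0 m0n.
(* The largest value strictly below [y n] would itself satisfy [P], against the minimality of
   [y n]. *)
case: (arg_maxP y m0n) => m mn mmax.
have Pm : P m.
  by apply: le_trans (ltW bad) (card_le_natr _ _ _) => k; apply: mmax.
by move: mn; rewrite /= ltNge nmin.
Qed.

End Quantile.

Theorem theorem1 (R : realType) (N D K : nat)
    (N_ge1 : (1 <= N)%N) (D_ge1 : (1 <= D)%N) (K_ge1 : (1 <= K)%N)
    (x : 'I_N -> 'cV[R]_D) (nu : R) (nu_gt0 : 0 < nu) (nu_lt1 : nu < 1)
    (g : R -> R) (g_act : is_activation g) (r0 : R)
    (w : 'cV[R]_K) (V : 'M[R]_(K, D))
    (wV_opt : is_argmin (weights_objective nu g x r0) (w, V)) :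
  let y := fun n : 'I_N => score g w V (x n) in
  (exists r : R, is_quantile nu y r) /\
  (forall r : R, is_argmin (bias_objective nu y) r <-> is_quantile nu y r).
Proof.
move=> y; split; first exact: exists_quantile.
by move=> r; split; [apply: argmin_quantile|apply: quantile_argmin].
Qed.
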